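(* Let $X$ be a separable Hausdorff topological space that contains a cocountable subset homeomorphic to $[0,\omega_1]$. Then for every integer $n\ge 2$ the space $X$ admits no diagonally continuous $n$-mean $\mu:X^n\to X$.
   Context: Here $\omega_1$ is the first uncountable ordinal and $[0,\omega_1]$ carries the order topology. A subset $A$ of a set $X$ is called cocountable if its complement $X\setminus A$ is at most countable; a cocountable subset of $X$ is considered with the subspace topology. A function $\mu:X^n\to X$ is called an $n$-mean if (1) $\mu(x,\dots,x)=x$ for every $x\in X$, and (2) $\mu$ is $S_n$-invariant, i.e. $\mu(x_{\sigma(1)},\dots,x_{\sigma(n)})=\mu(x_1,\dots,x_n)$ for any permutation $\sigma$ of $\{1,\dots,n\}$ and any $(x_1,\dots,x_n)\in X^n$. A function $f:X^n\to Y$ between topological spaces is called diagonally continuous if for any map $g=(g_i)_{i=1}^n:X\to X^n$ each of whose components $g_i:X\to X$, $1\le i\le n$, is either a constant function or the identity function, the composition $f\circ g:X\to Y$ is continuous. *)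

(* Defs.v *)
From HB Require Import structures.
From mathcomp Require Import all_boot all_order perm.
From mathcomp Require Import wochoice all_classical topology separation_axioms.

Set Implicit Arguments.
Unset Strict Implicit.
Unset Printing Implicit Defensive.

Import Order.TTheory.
Local Open Scope classical_set_scope.

(* [wo] is a well-order of the (uncountable) power set of [nat].  Its elements
   with at most countably many predecessors form an initial segment, which is
   uncountable, while all its proper initial segments are countable: it is the
   ordinal omega_1. *)
Definition wo : rel (set nat) := projT1 (well_ordering_principle (set nat)).

Definition omega1 : set (set nat) :=
  [set x | countable [set y | wo y x /\ y <> x]].

(* [Omega1] is [0, omega_1], the point omega_1 being [None]. *)
Definition Omega1 : Type := option omega1.

HB.instance Definition _ := Choice.on Omega1.

Definition Omega1_le (a b : Omega1) : bool :=
  match a, b with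
  | _, None => true
  | None, Some _ => false
  | Some x, Some y => wo (val x) (val y)
  end.

Lemma wo_min (A : set (set nat)) : A !=set0 ->
  exists2 z, A z & forall y, A y -> wo z y.
Proof.
move=> [x Ax].
have [|z [[zA zmin] _]] := projT2 (well_ordering_principle (set nat)) (mem A).
  by exists x; exact: mem_set.
by exists z => [|y Ay]; [exact: set_mem|apply: zmin; exact: mem_set].
Qed.

Lemma wo_total : total wo.
Proof.
move=> x y; have [|z] := @wo_min [set x; y]; first by exists x; left.
by move=> [->|->] H; apply/orP; [left|right]; apply: H; [right|left].
Qed.

Lemma wo_refl : reflexive wo.
Proof. by move=> x; have := wo_total x x; rewrite orbb. Qed.

Lemma wo_anti : antisymmetric wo.
Proof.
move=> x y /andP[xy yx].
have [|z [_ zuniq]] :=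
  projT2 (well_ordering_principle (set nat)) (mem [set x; y]).
  by exists x; apply: mem_set; left.
rewrite -(zuniq x) ?(zuniq y) //.
- split=> [|t /set_mem[->|->]] //; first by apply: mem_set; right.
  exact: wo_refl.
- split=> [|t /set_mem[->|->]] //; first by apply: mem_set; left.
  exact: wo_refl.
Qed.

Lemma wo_trans : transitive wo.
Proof.
move=> y x z xy yz.
have [|t] := @wo_min [set x; y; z]; first by exists x; left; left.
move=> [[]|] -> tmin.
- by apply: tmin; right.
- suff -> : x = y by [].
  by apply: wo_anti; rewrite xy tmin //; left; left.
- have zx : wo z x by apply: tmin; left; left.
  have zy : wo z y by apply: tmin; left; right.
  by have -> : z = y by apply: wo_anti; rewrite zy yz.
Qed.

Lemma Omega1_le_anti : antisymmetric Omega1_le.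
Proof.
by move=> [x|] [y|] //= H; congr Some; apply: val_inj; exact: wo_anti.
Qed.

Lemma Omega1_le_trans : transitive Omega1_le.
Proof. by move=> [y|] [x|] [z|] //=; exact: wo_trans. Qed.

Lemma Omega1_le_total : total Omega1_le.
Proof. by move=> [x|] [y|] //=; exact: wo_total. Qed.

Fact Omega1_display : Order.disp_t. Proof. exact: Order.Disp tt tt. Qed.

HB.instance Definition _ := Order.isOrder.Build Omega1_display Omega1
  (fun _ _ => erefl) (fun _ _ => erefl) (fun _ _ => erefl)
  Omega1_le_anti Omega1_le_trans Omega1_le_total.

HB.instance Definition _ :=
  OrderTopological.copy Omega1 (order_topology Omega1).

(* The next four lemmas characterize [Omega1] as an ordered set, up to
   isomorphism: well-ordered, with a largest element [None] that is its first
   element with uncountably many predecessors. *)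
Lemma Omega1_well_ordered (A : set Omega1) : A !=set0 ->
  exists2 z, A z & forall y, A y -> (z <= y)%O.
Proof.
move=> [a Aa].
have [[x Ax]|noA] := pselect (exists x, A (Some x)).
- have [|z [u Au uz] zmin] := @wo_min [set val u | u in [set u | A (Some u)]].
    by exists (val x), x.
  exists (Some u) => // -[y|] Ay //.
  by change (wo (val u) (val y)); rewrite uz; apply: zmin; exists y.
- case: a Aa => [x Ax|AN]; first by case: noA; exists x.
  by exists None => // -[y Ay|//]; case: noA; exists y.
Qed.

Lemma Omega1_le_top (a : Omega1) : (a <= None)%O.
Proof. by case: a. Qed.

Lemma Omega1_countable_lt (a : Omega1) : (a < None)%O ->
  countable [set b : Omega1 | (b < a)%O].
Proof.
case: a => [x _|]; last by rewrite ltxx.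
have /set_mem cx := valP x.
pose f (b : Omega1) : set nat := if b is Some u then val u else set0.
have f_inj : {in [set b : Omega1 | (b < Some x)%O] &, injective f}.
  move=> [u|] [v|] /set_mem /= ub /set_mem /= vb; rewrite /f.
  - by move=> /val_inj ->.
  - by move: vb; rewrite ltNge Omega1_le_top.
  - by move: ub; rewrite ltNge Omega1_le_top.
  - by [].
rewrite -(eq_countable (inj_card_eq f_inj)).
apply: sub_countable cx; apply: subset_card_le => _ [[u|] /= + <-]; last first.
  by rewrite ltNge Omega1_le_top.
rewrite lt_neqAle => /andP[/eqP ux leux]; split => // e.
by apply: ux; congr Some; exact: val_inj.
Qed.

Lemma Omega1_uncountable_lt_top :
  ~ countable [set b : Omega1 | (b < None)%O].
Proof.
move=> c; pose f (b : Omega1) : set nat := if b is Some u then val u else set0.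
have co : countable omega1.
  apply: (card_le_trans _ c).
  apply: card_le_trans (card_image_le f _); apply: subset_card_le => x ox.
  by exists (Some (exist _ x (mem_set ox))).
have oT : omega1 = setT.
  rewrite -subTset => y _; apply: contrapT => noy.
  have [|x nox xmin] := @wo_min (~` omega1); first by exists y.
  apply: nox.
  apply: sub_countable co; apply: subset_card_le => z [zx z_neq_x].
  by apply: contrapT => /xmin xz; apply: z_neq_x; apply: wo_anti; rewrite zx xz.
move: co; rewrite oT => /pcard_injP[g ginj0].
have ginj A B : g A = g B -> A = B by apply: ginj0; exact: in_setT.
pose D : set nat := [set n | exists2 A, g A = n & ~ A n].
have nD : ~ D (g D) by move=> /[dup] DgD [A /ginj ->]; exact.
by apply: (nD); exists D.
Qed.

Definition cocountable (T : Type) (A : set T) : Prop := countable (~` A).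

Definition separable_space (T : topologicalType) : Prop :=
  exists2 D : set T, countable D & dense D.

Definition homeomorphic (S T : topologicalType) : Prop :=
  exists (f : S -> T) (g : T -> S),
    [/\ cancel f g, cancel g f, continuous f & continuous g].

Definition n_mean (n : nat) (X : Type) (mu : ('I_n -> X) -> X) : Prop :=
  (forall x : X, mu (fun=> x) = x) /\
  (forall (s : 'S_n) (x : 'I_n -> X), mu (fun i => x (s i)) = mu x).

(* [X^n] is the type of functions from ['I_n] to [X]; its topology plays no
   role here. *)
Definition diagonally_continuous (n : nat) (X Y : topologicalType)
    (f : ('I_n -> X) -> Y) : Prop :=
  forall g : 'I_n -> X -> X,
    (forall i, (exists c : X, g i = cst c) \/ g i = id) ->
    continuous (fun x => f (fun i => g i x)).

(* Main.v *)
Require Import Defs.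
From mathcomp Require Import all_boot all_order perm interval.
From mathcomp Require Import all_classical topology separation_axioms.

(** The proof only uses that a diagonally continuous mean is continuous in each
variable separately.

Let [j] embed [0, omega_1] in [X] with cocountable image.  A continuous map [u]
from [0, omega_1] to [X] avoids, near omega_1, any countable set that does not
contain its value at omega_1.  Hence, near omega_1, each value of [u] is either
[u omega_1] or a value of [j] at a point that is itself close to omega_1.  If
[u] is not constant near omega_1, the Hausdorff property forces
[u omega_1 = j omega_1], and a closing-off argument gives [u = j] on a closed
unbounded set ([constant_or_embedding]).  Countably many closed unbounded sets have a common
point, so for any countable family of continuous maps [h : X -> X] there are
three points of [X] on which each [h] is the identity or is constant
([common_three_points]).

Apply this to the sections [a |-> mu (x_1, .., a, .., x_n)] whose fixed
coordinates run over a countable dense set.  Being the identity on the three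
points, or being constant there, is a closed condition on each fixed
coordinate; replacing the coordinates one at a time, all sections of [mu] are
the identity or constant on the three points ([sections_fix_or_merge]).  This is
where separability is indispensable: [0, omega_1] itself has the mean [max].

The rest is combinatorial: an operation on at least three points all of whose
sections are the identity or constant is a projection or a constant
([projection_or_constant]).  A symmetric idempotent operation in at least two
variables is neither. *)

Set Implicit Arguments.
Unset Strict Implicit.
Unset Printing Implicit Defensive.

Import Order.TTheory.
Local Open Scope classical_set_scope.

Local Notation w1 := (None : Omega1).

(** * Countable ordinals *)

Lemma countable_setU {T : Type} (A B : set T) :
  countable A -> countable B -> countable (A `|` B).
Proof.
move=> cA cB; have -> : A `|` B = \bigcup_(b : bool) (if b then A else B).
  apply/seteqP; split=> [x [Ax|Bx]|x [[] _ /= ?]]; [| |by left|by right].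
  - by exists true.
  - by exists false.
by apply: bigcup_countable => // -[].
Qed.

Lemma countable_le (s : Omega1) : (s < w1)%O ->
  countable ([set b : Omega1 | (b < s)%O] `|` [set s]).
Proof. by move=> s_lt; apply: countable_setU => //; exact: Omega1_countable_lt. Qed.

Lemma countable_ordinal_exists : exists x : Omega1, (x < w1)%O.
Proof.
apply: contrapT => no; apply: Omega1_uncountable_lt_top.
rewrite (_ : [set _ | _] = set0) //; apply/seteqP; split=> // x xlt.
by apply: no; exists x.
Qed.

(** The cofinality of omega_1 is uncountable: otherwise [0, omega_1) would be a
countable union of initial segments [0, s], all of them countable. *)
Lemma countable_bounded (S : set Omega1) :
  countable S -> (forall s, S s -> (s < w1)%O) ->
  exists2 b : Omega1, (b < w1)%O & forall s, S s -> (s < b)%O.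
Proof.
move=> cS Slt; apply: contrapT => nob; apply: Omega1_uncountable_lt_top.
have cover : [set b : Omega1 | (b < w1)%O] `<=`
    \bigcup_(s in S) ([set b : Omega1 | (b < s)%O] `|` [set s]).
  move=> b blt; apply: contrapT => nocover; apply: nob; exists b => // s Ss.
  rewrite ltNge; apply/negP; rewrite le_eqVlt => bs; apply: nocover.
  by exists s => //; case/orP: bs => [/eqP|]; [right|left].
apply: sub_countable (subset_card_le cover) _.
by apply: bigcup_countable => // s Ss; exact/countable_le/Slt.
Qed.

Lemma left_nbhs {d} {T : orderTopologicalType d} (b c : T) (U : set T) :
  (b < c)%O -> nbhs c U ->
  exists2 g : T, (g < c)%O & forall x, (g < x)%O -> (x <= c)%O -> U x.
Proof.
move=> bc; rewrite itv_nbhsE => -[[l r]] [iopen /andP[lc cr]] iU.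
have right_end x : (x <= c)%O -> (BRight x <= r)%O.
  by move=> xc; apply: le_trans cr.
case: l iopen lc iU => [[] g|[]] // iopen lc iU.
- exists g => [|x gx xc]; first by [].
  by apply: iU; apply/andP; split; [|exact: right_end].
- by exists b => // x bx xc; apply: iU; apply/andP; split; [|exact: right_end].
Qed.

Definition closed_under (phi : Omega1 -> Omega1) (c : Omega1) : Prop :=
  forall x, (x < c)%O -> (phi x < c)%O.

(** Countably many closed unbounded sets have arbitrarily large common points:
iterate omega times a step that goes beyond every value taken so far by every
[phi t], and let [c] be the supremum of the iterates. *)
Lemma common_closed_point {T : countType} (phi : T -> Omega1 -> Omega1)
    (a : Omega1) :
  (forall t x, (x < w1)%O -> (phi t x < w1)%O) -> (a < w1)%O ->
  exists2 c : Omega1, (a < c < w1)%O & forall t, closed_under (phi t) c.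
Proof.
move=> phi_lt a_lt.
have step (s : Omega1) : exists s' : Omega1, (s < w1)%O ->
    [/\ (s' < w1)%O, (s < s')%O &
        forall t x, (x <= s)%O -> (phi t x < s')%O].
  have [s_lt|s_ge] := boolP (s < w1)%O; last by exists s.
  pose below : set Omega1 := [set x | (x < s)%O] `|` [set s].
  pose S := [set s] `|` \bigcup_(t : T) (phi t @` below).
  have [|u|b b_lt bS] := @countable_bounded S.
  - apply: countable_setU => //; apply: bigcup_countable => // t _.
    exact: card_le_trans (card_image_le _ _) (countable_le s_lt).
  - case=> [->//|[t _ [x xs <-]]]; apply: phi_lt.
    by case: xs => [xs|->//]; exact: lt_trans s_lt.
  - exists b => _; split=> // [|t x xs]; first by apply: bS; left.
    apply: bS; right; exists t => //; exists x => //.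
    by move: xs; rewrite le_eqVlt => /orP[/eqP ->|]; [right|left].
have [next nextP] := choice step.
pose s k := iter k next a.
have s_lt k : (s k < w1)%O.
  by elim: k => [|k IH] //=; have [] := nextP _ IH.
have [|u [k _ <-]//|b b_lt bs] := @countable_bounded (range s).
  exact: card_le_trans (card_image_le _ _) _.
have [|c /= cs cmin] := @Omega1_well_ordered [set c | forall k, (s k < c)%O].
  by exists b => k; apply: bs; exists k.
exists c => [|t x xc].
- rewrite (cs 0%N) /=.
  by apply: le_lt_trans b_lt; apply: cmin => k; apply: bs; exists k.
- have [k xsk] : exists k, (x <= s k)%O.
    apply: contrapT => nok; move: xc; rewrite ltNge => /negP; apply.
    apply: cmin => k; rewrite ltNge; apply/negP => xsk.
    by apply: nok; exists k.
  by apply: lt_trans (cs k.+1); have [_ _] := nextP _ (s_lt k); apply.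
Qed.

(** * Continuous maps from [0, omega_1] *)

Lemma open_neq {X Y : topologicalType} (f g : X -> Y) : hausdorff_space Y ->
  continuous f -> continuous g -> open [set x | f x <> g x].
Proof.
rewrite open_hausdorff => hY cf cg; rewrite openE => x /eqP /hY.
move=> [[U V] /= [Ux Vx] [oU oV /eqP UV]].
have nU : nbhs x (f @^-1` U).
  by apply: cf; apply: open_nbhs_nbhs; split=> //; exact: set_mem.
have nV : nbhs x (g @^-1` V).
  by apply: cg; apply: open_nbhs_nbhs; split=> //; exact: set_mem.
apply: filterS (filterI nU nV) => y [/= Uy Vy] fg.
suff : (U `&` V) (f y) by rewrite UV.
by split=> //; rewrite /= fg.
Qed.

(** Each point of [S] is avoided on a tail [(b, omega_1]], and countably many
tails have a common one. *)
Lemma eventually_avoids {X : topologicalType} (u : Omega1 -> X) (S : set X) :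
  hausdorff_space X -> continuous u -> countable S -> ~ S (u w1) ->
  exists2 b : Omega1, (b < w1)%O & forall x, (b < x)%O -> ~ S (u x).
Proof.
move=> X_T2 cu cS nSu; have [x0 x0_lt] := countable_ordinal_exists.
have bound (q : X) : exists b : Omega1,
    S q -> (b < w1)%O /\ forall x, (b < x)%O -> u x <> q.
  have [Sq|nSq] := pselect (S q); last by exists w1.
  have nq : nbhs w1 [set x | u x <> q].
    apply: open_nbhs_nbhs; split; last by move=> /= uq; apply: nSu; rewrite uq.
    by apply: (@open_neq _ _ u (cst q)) => //; exact: cst_continuous.
  have [b b_lt bq] := left_nbhs x0_lt nq.
  by exists b => _; split=> // x bx; apply: bq => //; exact: Omega1_le_top.
have [beta betaP] := choice bound.
have [|s [q Sq <-]|b b_lt bS] := @countable_bounded (beta @` S).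
- exact: card_le_trans (card_image_le _ _) cS.
- by have [] := betaP _ Sq.
- exists b => // x bx Sux; have [_ /(_ x) H] := betaP _ Sux.
  by apply: H => //; apply: lt_trans bx; apply: bS; exists (u x).
Qed.

Definition fixes_or_merges {X : Type} (C : set X) (h : X -> X) : Prop :=
  (forall a, C a -> h a = a) \/ (forall a b, C a -> C b -> h a = h b).

Section CocountableEmbedding.
Context {X : topologicalType} (j : Omega1 -> X).
Hypotheses (X_T2 : hausdorff_space X) (j_cont : continuous j)
  (j_inj : injective j)
  (j_open : forall U, open U -> exists2 W, open W & j @^-1` W = U)
  (j_coc : cocountable (range j)).
Implicit Types u : Omega1 -> X.

(** The complement of [j ((g, omega_1])] is countable, so [u] avoids all of it
near omega_1, except possibly the value [u omega_1]. *)
Lemma eventually_tail u (g : Omega1) : continuous u -> (g < w1)%O ->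
  exists2 b : Omega1, (b < w1)%O & forall x, (b < x)%O ->
    u x = u w1 \/ exists2 y : Omega1, (g < y)%O & u x = j y.
Proof.
move=> cu g_lt.
pose S := (~` range j `|` j @` ([set y | (y < g)%O] `|` [set g])) `\ u w1.
have [||b b_lt bS] := @eventually_avoids _ u S X_T2 cu.
- apply: sub_countable (subset_card_le (@subDsetl _ _ _)) _.
  apply: countable_setU => //.
  exact: card_le_trans (card_image_le _ _) (countable_le g_lt).
- by case=> _; apply.
- exists b => // x bx; apply: contrapT => /not_orP[ne no].
  apply: (bS _ bx); split=> //.
  apply: contrapT => /not_orP[/contrapT[y _ jy] no'].
  apply: no; exists y => //; rewrite ltNge; apply/negP => yg; apply: no'.
  by exists y => //; move: yg; rewrite le_eqVlt => /orP[/eqP|]; [right|left].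
Qed.

(** Separate [u omega_1] from [j omega_1] by open sets [U] and [V]: near
omega_1, [u] takes its values in [U], and the values of [j] are in [V]. *)
Lemma eventually_constant u : continuous u -> u w1 <> j w1 ->
  exists2 b : Omega1, (b < w1)%O & forall x, (b < x)%O -> u x = u w1.
Proof.
move=> cu /eqP; move: (X_T2); rewrite open_hausdorff => /[apply].
move=> [[U V] /= [Uu Vj] [oU oV /eqP UV]].
have [b0 b0_lt] := countable_ordinal_exists.
have nV : nbhs w1 (j @^-1` V).
  by apply: j_cont; apply: open_nbhs_nbhs; split=> //; exact: set_mem.
have nU : nbhs w1 (u @^-1` U).
  by apply: cu; apply: open_nbhs_nbhs; split=> //; exact: set_mem.
have [g g_lt gV] := left_nbhs b0_lt nV.
have [b b_lt bU] := left_nbhs b0_lt nU.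
have [b' b'_lt b'P] := eventually_tail cu g_lt.
exists (Order.max b b') => [|x]; first by rewrite gt_max b_lt.
rewrite gt_max => /andP[bx b'x]; have [//|[y gy uy]] := b'P _ b'x.
suff : (U `&` V) (u x) by rewrite UV.
split; first exact: bU bx (Omega1_le_top _).
by rewrite uy; apply: gV gy (Omega1_le_top _).
Qed.

(** The ordinals [c] closed under [phi] form the closed unbounded set.  When [u]
is not constant near omega_1, each countable [g] has an [x > g] such that [u x]
is [j y] for a countable [y], and such that beyond [x] the values of [u] are
values of [j] beyond [g].  If [phi g] bounds these [x] and [y], then at a [c]
closed under [phi] the second property gives [u c = j e] with [e >= c], and the
first one shows that [u c] is a limit of values [j y] with [y < c], so that
[e <= c].  The hypothesis [a < c] discards the ordinal 0, which is vacuously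
closed under every function. *)
Lemma constant_or_embedding u : continuous u ->
  exists phi : Omega1 -> Omega1, (forall x, (x < w1)%O -> (phi x < w1)%O) /\
    ((u w1 = j w1 /\
      forall a c, (a < c < w1)%O -> closed_under phi c -> u c = j c) \/
     (forall a c, (a < c < w1)%O -> closed_under phi c -> u c = u w1)).
Proof.
move=> cu.
have [[b b_lt ub]|not_const] := pselect
    (exists2 b : Omega1, (b < w1)%O & forall x, (b < x)%O -> u x = u w1).
  exists (fun=> b); split=> //; right=> a c /andP[ac _] cP.
  by apply: ub; exact: cP ac.
have uw1 : u w1 = j w1.
  by apply: contrapT => /(eventually_constant cu).
have escape (g : Omega1) : exists m : Omega1, (g < w1)%O ->
    exists x y : Omega1,
    [/\ (m < w1)%O, (g < x <= m)%O, (y <= m)%O, u x = j y &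
      forall z, (x < z)%O -> exists2 e : Omega1, (g < e)%O & u z = j e].
  have [g_lt|] := boolP (g < w1)%O; last by exists g.
  have [b b_lt bP] := eventually_tail cu g_lt.
  have tail z : (b < z)%O -> exists2 e : Omega1, (g < e)%O & u z = j e.
    by move=> /bP[->|//]; exists w1.
  have [x bgx ux] : exists2 x : Omega1, (Order.max b g < x)%O & u x <> u w1.
    apply: contrapT => no; apply: not_const; exists (Order.max b g).
      by rewrite gt_max b_lt.
    by move=> x bgx; apply: contrapT => ux; apply: no; exists x.
  move: (bgx); rewrite gt_max => /andP[bx gx].
  have [y gy uxy] := tail _ bx.
  have x_lt : (x < w1)%O.
    by rewrite lt_neqAle Omega1_le_top andbT; apply/eqP => xw; rewrite xw in ux.
  have y_lt : (y < w1)%O.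
    rewrite lt_neqAle Omega1_le_top andbT; apply/eqP => yw.
    by apply: ux; rewrite uxy yw.
  exists (Order.max x y) => _; exists x, y; split=> //.
  - by rewrite gt_max x_lt.
  - by rewrite gx le_max lexx.
  - by rewrite le_max lexx orbT.
  - by move=> z xz; apply: tail; exact: lt_trans xz.
have [phi phiP] := choice escape.
exists phi; split=> [x /phiP[y [z []]] //|].
left; split=> // a c /andP[ac c_lt] cP.
have above g : (g < c)%O -> exists2 e : Omega1, (g < e)%O & u c = j e.
  move=> gc; have [x [y [_ /andP[_ xm] _ _]]] := phiP _ (lt_trans gc c_lt).
  by apply; apply: le_lt_trans xm (cP _ gc).
have [e _ uce] := above _ ac.
have ce : (c <= e)%O.
  rewrite leNgt; apply/negP => /above[e' ee' uce'].
  by move: ee'; rewrite (j_inj (etrans (esym uce) uce')) ltxx.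
move: (ce); rewrite le_eqVlt => /orP[/eqP c_eq_e|c_lt_e].
  by rewrite {2}c_eq_e.
have [W oW jW] := j_open (rray_open c).
have nW : nbhs c (u @^-1` W).
  apply: cu; apply: open_nbhs_nbhs; split=> //.
  have : (j @^-1` W) e by rewrite jW /= in_itv /= c_lt_e.
  by rewrite uce.
have [g gc gW] := left_nbhs ac nW.
have [x [y [_ /andP[gx xm] ym uxy _]]] := phiP _ (lt_trans gc c_lt).
have /= Wux := gW _ gx (ltW (le_lt_trans xm (cP _ gc))).
have : (j @^-1` W) y by rewrite /= -uxy.
rewrite jW /= in_itv /= andbT => cy.
by have := lt_trans cy (le_lt_trans ym (cP _ gc)); rewrite ltxx.
Qed.

(** Two common points of the closed unbounded sets attached to the maps
[h t \o j], together with omega_1, where the limiting behaviour is attained. *)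
Lemma common_three_points {T : countType} (h : T -> X -> X) :
  (forall t, continuous (h t)) -> exists a b c : X,
  uniq [:: a; b; c] /\ forall t, fixes_or_merges [set` [:: a; b; c]] (h t).
Proof.
move=> ch.
have hj_cont t : continuous (h t \o j).
  by move=> x; apply: continuous_comp; [exact: j_cont|exact: ch].
have [phi phiP] := choice (fun t => constant_or_embedding (hj_cont t)).
have [a0 a0_lt] := countable_ordinal_exists.
have phi_lt t x : (x < w1)%O -> (phi t x < w1)%O by have [+ _] := phiP t; apply.
have [a /andP[a0a a_lt] aP] := common_closed_point phi_lt a0_lt.
have [b /andP[ab b_lt] bP] := common_closed_point phi_lt a_lt.
exists (j a), (j b), (j w1); split.
  by rewrite /= !inE !(inj_eq j_inj) !lt_eqF // (lt_trans ab).
move=> t; have [_ [[hw1 fixes]|merges]] := phiP t.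
- left=> x /=; rewrite !inE => /or3P[] /eqP -> //.
  + by apply: (fixes a0) => //; rewrite a0a.
  + by apply: (fixes a) => //; rewrite ab.
- have value x : x \in [:: j a; j b; j w1] -> h t x = h t (j w1).
    rewrite !inE => /or3P[] /eqP -> //.
    + by apply: (merges a0) => //; rewrite a0a.
    + by apply: (merges a) => //; rewrite ab.
  by right=> x y /value -> /value ->.
Qed.
End CocountableEmbedding.

(** * Operations whose sections are identities or constants *)

Section Coordinates.
Context {n : nat} {X : Type}.
Implicit Types (i k : 'I_n) (x y : 'I_n -> X) (a b : X).

Definition update x i a : 'I_n -> X := fun k => if k == i then a else x k.

Lemma update_same x i : update x i (x i) = x.
Proof. by apply/funext => k; rewrite /update; case: eqP => // ->. Qed.

Lemma update_update x i a b : update (update x i a) i b = update x i b.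
Proof. by apply/funext => k; rewrite /update; case: eqP. Qed.

Lemma updateC x i k a b : i != k ->
  update (update x i a) k b = update (update x k b) i a.
Proof.
move=> ik; apply/funext => l; rewrite /update.
by case: (eqVneq l k) => // ->; rewrite eq_sym (negbTE ik).
Qed.

Lemma update_mem (C : set X) x i a :
  (forall k, C (x k)) -> C a -> forall k, C (update x i a k).
Proof. by move=> Cx Ca k; rewrite /update; case: ifP. Qed.

(** One passes from [x] to [y] by changing the coordinates one at a time. *)
Lemma updates_connect (C : set X) (P : ('I_n -> X) -> Prop) x y :
  (forall z k c, (forall l, C (z l)) -> C c -> P z -> P (update z k c)) ->
  (forall k, C (x k)) -> (forall k, C (y k)) -> P x -> P y.
Proof.
move=> Pstep Cx Cy Px.
have main (s : seq 'I_n) : P (fun k => if k \in s then y k else x k).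
  elim: s => [//|l s IH].
  pose z k := if k \in s then y k else x k.
  suff -> : (fun k => if k \in l :: s then y k else x k) = update z l (y l).
    by apply: Pstep => // k; rewrite /z; case: ifP.
  apply/funext => k; rewrite /z /update inE.
  by case: eqVneq => //= ->.
suff <- : (fun k => if k \in enum 'I_n then y k else x k) = y by [].
by apply/funext => k; rewrite mem_enum.
Qed.

(** Suppose that the section of [f] in the coordinate [i] is the identity.  Its
value at [a] depends on the coordinate [k] only if the section in [k] is the
identity, that is, only if [a] is the [k]-th coordinate.  So when the [k]-th
coordinate is changed, the new section in [i] still fixes all [a] but one; as
there are two others, it is not constant, hence it is the identity.  Therefore
all sections in [i] are identities.  The first hypothesis says that [C] has at
least three points; it is needed, as the median of three variables shows on a
set of two points. *)
Lemma projection_or_constant (f : ('I_n -> X) -> X) (C : set X) :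
  (forall a, exists b b', [/\ C b, C b', b <> b', b <> a & b' <> a]) ->
  (forall x i, fixes_or_merges C (fun a => f (update x i a))) ->
  (exists i, forall x, (forall k, C (x k)) -> f x = x i) \/
  (forall x y, (forall k, C (x k)) -> (forall k, C (y k)) -> f x = f y).
Proof.
move=> C3 fP.
have [[i [x0 [Cx0 fix0]]]|nofix] := pselect (exists i x,
  (forall k, C (x k)) /\ forall a, C a -> f (update x i a) = a).
- left; exists i => x Cx.
  pose fixes z := forall a, C a -> f (update z i a) = a.
  suff : fixes x by move=> /(_ _ (Cx i)); rewrite update_same.
  apply: (@updates_connect C fixes x0) => // z k c Cz Cc fixz.
  have [<-|ik] := eqVneq i k.
    by move=> a Ca; rewrite update_update; apply: fixz.
  have step a : C a -> a <> z k -> f (update (update z k c) i a) = a.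
    move=> Ca azk; rewrite -updateC //.
    have zk : update (update z i a) k (z k) = update z i a.
      by rewrite updateC // update_same.
    have [fixk|mergek] := fP (update z i a) k.
      by case: azk; rewrite -(fixk _ (Cz k)) zk fixz.
    by rewrite (mergek _ (z k)) // zk fixz.
  have [//|merge] := fP (update z k c) i.
  have [b [b' [Cb Cb' bb' bz b'z]]] := C3 (z k).
  by case: bb'; rewrite -(step b) // (merge _ b') // step.
- right=> x y Cx Cy; symmetry.
  apply: (@updates_connect C (fun z => f z = f x) x) => // z k c Cz Cc <-.
  have [fixk|mergek] := fP z k; first by case: nofix; exists k, z.
  by rewrite (mergek _ (z k)) // update_same.
Qed.

Lemma mean_not_projection_or_constant (f : ('I_n -> X) -> X) (C : set X) b b' :
  (1 < n)%N -> C b -> C b' -> b <> b' -> n_mean f ->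
  ~ ((exists i, forall x, (forall k, C (x k)) -> f x = x i) \/
  (forall x y, (forall k, C (x k)) -> (forall k, C (y k)) -> f x = f y)).
Proof.
move=> n_gt1 Cb Cb' bb' [f_id f_sym] [[i fi]|fconst]; last first.
  by apply: bb'; rewrite -(f_id b) -(f_id b'); apply: fconst.
have [k ik] : exists k, k != i.
  have : (0 < #|predC1 i|)%N by rewrite cardC1 card_ord; case: n n_gt1 => [|[]].
  by case/card_gt0P => k; rewrite !inE => ik; exists k.
pose x := update (fun=> b') i b.
have Cx l : C (x l) by apply: update_mem.
apply: bb'; have := f_sym (tperm i k) x.
rewrite (fi x) // fi => [|l]; last exact: Cx.
by rewrite tpermL /x /update eqxx (negbTE ik).
Qed.
End Coordinates.

Lemma two_others {X : eqType} (a b c : X) : uniq [:: a; b; c] ->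
  forall x, exists y z, [/\ [set` [:: a; b; c]] y, [set` [:: a; b; c]] z,
    y <> z, y <> x & z <> x].
Proof.
rewrite /= !inE negb_or andbT => /andP[/andP[/eqP ab /eqP ac] /eqP bc] x.
have [->|/eqP ax] := eqVneq x a.
  by exists b, c; split=> //=; rewrite ?inE ?eqxx ?orbT //; exact: nesym.
have [->|/eqP bx] := eqVneq x b.
  by exists a, c; split=> //=; rewrite ?inE ?eqxx ?orbT //; exact: nesym.
by exists a, b; split=> //=; rewrite ?inE ?eqxx ?orbT //; exact: nesym.
Qed.

(** * Sections of a separately continuous operation *)

Lemma diagonally_continuous_update {n : nat} {X : topologicalType}
    (mu : ('I_n -> X) -> X) (x : 'I_n -> X) i :
  diagonally_continuous mu -> continuous (fun a => mu (update x i a)).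
Proof.
move=> cmu; pose g k : X -> X := if k == i then id else cst (x k).
have -> : (fun a => mu (update x i a)) = (fun a => mu (fun k => g k a)).
  apply/funext => a; congr mu; apply/funext => k.
  by rewrite /g /update; case: ifP.
apply: cmu => k; rewrite /g.
by case: ifP => _; [right|left; exists (x k)].
Qed.

(** Each of the two alternatives is a closed condition on [y]. *)
Lemma fixes_or_merges_dense {X Y : topologicalType} (E : set Y) (C : set X)
    (w : X -> Y -> X) : hausdorff_space X -> dense E ->
  (forall a, continuous (w a)) ->
  (forall d, E d -> fixes_or_merges C (w^~ d)) ->
  forall y, fixes_or_merges C (w^~ y).
Proof.
move=> X_T2 dE cw fE y; apply: contrapT => /not_orP[nofix nomerge].
have {nofix}[a Ca wa] : exists2 a, C a & w a y <> a.
  apply: contrapT => no; apply: nofix => a Ca; apply: contrapT => wa.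
  by apply: no; exists a.
have {nomerge}[b [b' [Cb Cb' wb]]] :
    exists b b', [/\ C b, C b' & w b y <> w b' y].
  apply: contrapT => no; apply: nomerge => b b' Cb Cb'; apply: contrapT => wb.
  by apply: no; exists b, b'.
pose O := [set z | w a z <> a] `&` [set z | w b z <> w b' z].
have [||z [[Oa Ob] Ez]] := dE O.
- by exists y.
- apply: openI; apply: open_neq => //; exact: cst_continuous.
- by case: (fE _ Ez) => [/(_ _ Ca)|/(_ _ _ Cb Cb')].
Qed.

(** The coordinates are released from the dense set [E] one at a time, since
[mu] is continuous in each variable but not jointly. *)
Lemma sections_fix_or_merge {X : topologicalType} {n : nat} (E C : set X)
    (mu : ('I_n -> X) -> X) :
  hausdorff_space X -> dense E ->
  (forall x i, continuous (fun a => mu (update x i a))) ->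
  (forall x i, (forall k, E (x k)) ->
    fixes_or_merges C (fun a => mu (update x i a))) ->
  forall x i, fixes_or_merges C (fun a => mu (update x i a)).
Proof.
move=> X_T2 dE cmu fE x i.
suff main (s : seq 'I_n) : forall x, (forall k, k \notin s -> E (x k)) ->
    fixes_or_merges C (fun a => mu (update x i a)).
  by apply: (main (enum 'I_n)) => k; rewrite mem_enum.
elim: s => [|k s IH] {}x xE; first by apply: fE => k; exact: xE.
rewrite -(update_same x k).
pose w a d := mu (update (update x k d) i a).
apply: (@fixes_or_merges_dense _ _ E C w) => // [a|d Ed]; rewrite /w.
  have [->|ik] := eqVneq i k.
    by under eq_fun do rewrite update_update; exact: cst_continuous.
  by under eq_fun do rewrite updateC 1?eq_sym //; exact: cmu.
apply: IH => l ls; rewrite /update; case: eqVneq => // lk.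
by apply: xE; rewrite inE negb_or lk.
Qed.

(** * Nonexistence of means *)

Lemma subspace_embedding {X K : topologicalType} (A : set X) :
  homeomorphic A K ->
  exists j : K -> X, [/\ continuous j, injective j, range j = A &
    forall U, open U -> exists2 W, open W & j @^-1` W = U].
Proof.
move=> [f [g [fK gK cf cg]]].
exists (set_val \o g); split.
- by move=> x; apply: continuous_comp; [exact: cg|exact: initial_continuous].
- by move=> x y /val_inj /(can_inj gK).
- apply/seteqP; split=> [_ [x _ <-]|a Aa]; first by apply: set_mem (valP (g x)).
  by exists (f (SigSub (mem_set Aa))) => //=; rewrite fK.
- move=> U oU; have [W oW WU] : open (f @^-1` U).
    by move/continuousP: cf; apply.
  exists W => //; rewrite comp_preimage WU.
  by apply/seteqP; split=> x /=; rewrite gK.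
Qed.

(* The subset [A] carries the subspace topology, through the coercion of sets
   to types [set_type]. *)
Theorem theorem1 (X : topologicalType) (hsep : separable_space X)
    (hT2 : hausdorff_space X)
    (hX : exists2 A : set X, cocountable A & homeomorphic A Omega1)
    (n : nat) (hn : (2 <= n)%N) :
  ~ exists mu : ('I_n -> X) -> X, n_mean mu /\ diagonally_continuous mu.
Proof.
move=> [mu [mean cmu]].
have [A A_coc /subspace_embedding[j [j_cont j_inj jA j_open]]] := hX.
have j_coc : cocountable (range j) by rewrite jA.
have [E E_count E_dense] := hsep.
have [e0 [_ Ee0]] : (setT `&` E) !=set0.
  by apply: E_dense; [exists (j None)|exact: openT].
have [e eE] : exists e : nat -> X, E = range e.
  have [E0|[f]] := pfcard_geP E_count; first by move: Ee0; rewrite E0.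
  have /surjfunPex[e eE] : $|{surjfun [set: nat] >-> E}| by squash f.
  by exists e.
(* Tuples of points of [E] are encoded by tuples of integers, so that the family
   of sections is indexed by a countable type. *)
pose section (t : {ffun 'I_n -> nat} * 'I_n) a := mu (update (e \o t.1) t.2 a).
have section_cont t : continuous (section t).
  exact: diagonally_continuous_update.
have [a [b [c [abc C_sections]]]] :=
  common_three_points hT2 j_cont j_inj j_open j_coc section_cont.
have [y [z [Cy Cz yz _ _]]] := two_others abc a.
apply: (mean_not_projection_or_constant hn Cy Cz yz mean).
apply: projection_or_constant (two_others abc) _.
apply: (sections_fix_or_merge hT2 E_dense) => [x i|x i xE].
  exact: diagonally_continuous_update.
have code k : exists m, e m = x k.
  by have := xE k; rewrite eE => -[m _ <-]; exists m.
have [t tx] := choice code.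
have := C_sections (finfun t, i).
rewrite /section /=; suff -> : e \o finfun t = x by [].
by apply/funext => k /=; rewrite ffunE.
Qed.
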